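(* Let $G$ be an $r$-uniform hypergraph with at least one edge. Then the function $h_G(p)=p\log\lambda^{(p)}(G)$ is convex (concave upward) on the interval $(r,\infty)$.
   Context: An $r$-uniform hypergraph $G$ consists of a finite vertex set $V(G)=\{1,\dots,n\}$ and a set $E(G)$ of $r$-element subsets of $V(G)$ (edges). For $\bm{x}\in\mathbb{R}^n$ let $P_G(\bm{x})=r\sum_{\{i_1,\ldots,i_r\}\in E(G)}x_{i_1}\cdots x_{i_r}$, and for real $p\ge1$ let $\|\bm{x}\|_p=(|x_1|^p+\cdots+|x_n|^p)^{1/p}$. The $p$-spectral radius of $G$ is $\lambda^{(p)}(G)=\max_{\|\bm{x}\|_p=1}P_G(\bm{x})$. *)

(* Defs.v *)
From mathcomp Require Import all_boot all_order all_algebra.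
From mathcomp Require Import all_classical all_reals all_analysis.
Import Order.TTheory GRing.Theory Num.Theory.
Import numFieldNormedType.Exports.

Set Implicit Arguments.
Unset Strict Implicit.
Unset Printing Implicit Defensive.

Local Open Scope classical_set_scope.
Local Open Scope ring_scope.

(* The vertices 1, ..., n are represented by 'I_n. *)
Record uhypergraph (n r : nat) := UHypergraph {
  edges : {set {set 'I_n}};
  edges_uniform : forall e, e \in edges -> #|e| = r
}.

Definition hpoly (R : realType) (n r : nat) (G : uhypergraph n r)
    (x : 'rV[R]_n) : R :=
  r%:R * \sum_(e in edges G) \prod_(i in e) x 0 i.

Definition pnorm (R : realType) (n : nat) (p : R) (x : 'rV[R]_n) : R :=
  (\sum_i `|x 0 i| `^ p) `^ p^-1.

Definition psphere (R : realType) (n : nat) (p : R) : set 'rV[R]_n :=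
  [set x | pnorm p x = 1].

(* The supremum is a maximum: see pspectral_radius_max below. *)
Definition pspectral_radius (R : realType) (n r : nat) (G : uhypergraph n r)
    (p : R) : R :=
  sup [set hpoly G x | x in @psphere R n p].

Definition hfun (R : realType) (n r : nat) (G : uhypergraph n r) (p : R) : R :=
  p * ln (pspectral_radius G p).

Lemma continuous_norm_powR (R : realType) (p : R) : 0 < p ->
  continuous (fun t : R => `|t| `^ p).
Proof.
move=> p0 t; have [->|t0] := eqVneq t 0.
  suff : (`|s| `^ p) @[s --> (0 : R)] --> (0 : R).
    by rewrite /continuous_at normr0 powR0 ?gt_eqF.
  apply/(@cvgr0Pnorm_lt R R^o) => e e0; near=> s.
  rewrite ger0_norm ?powR_ge0//.
  have -> : e = (e `^ p^-1) `^ p.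
    by rewrite -powRrM mulVf ?gt_eqF// powRr1// ltW.
  apply: gt0_ltr_powR; rewrite ?nnegrE ?powR_ge0//.
  by near: s; apply: (@cvgr0_norm_lt R R^o _ _ _ id) => //; rewrite powR_gt0.
have expE : \forall s \near t, expR (p * ln `|s|) = `|s| `^ p.
  have : \forall s \near t, s != 0.
    by apply: open_nbhs_nbhs; split; [exact: open_neq|].
  by apply: filterS => s s0; rewrite /powR normr_eq0 (negbTE s0).
rewrite /continuous_at {2}/powR normr_eq0 (negbTE t0).
apply: cvg_trans; first exact: (near_eq_cvg expE).
apply: continuous_cvg; first exact: continuous_expR.
apply: cvgMr; apply: continuous_cvg.
  by apply: continuous_ln; rewrite normr_gt0.
exact: norm_continuous.
Unshelve. all: by end_near. Qed.

Lemma pnorm_eq1 (R : realType) (n : nat) (p : R) (x : 'rV[R]_n) : 0 < p ->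
  pnorm p x = 1 <-> \sum_i `|x 0 i| `^ p = 1.
Proof.
move=> p0; split=> [/eqP|]; last by rewrite /pnorm => ->; rewrite powR1.
rewrite /pnorm powR_eq1 invr_eq0 (gt_eqF p0) orbF ltNge.
by rewrite sumr_ge0 ?orbF => [/eqP//|i _]; exact: powR_ge0.
Qed.

Lemma compact_psphere (R : realType) (n : nat) (p : R) : 0 < p ->
  compact (@psphere R n p).
Proof.
move=> p0.
have -> : @psphere R n p =
    (fun x : 'rV[R]_n => \sum_i `|x 0 i| `^ p) @^-1` [set 1].
  by apply/seteqP; split=> x /=; rewrite /psphere /= pnorm_eq1.
have cK : compact [set v : 'rV[R]_n | forall i, v ord0 i \in `[-1, 1]].
  apply: (@rV_compact R n (fun=> `[-1, 1]%classic)) => _.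
  exact: segment_compact.
apply: (subclosed_compact _ cK).
  apply: preimage_closed; last exact: closed_eq.
  move=> + _.
  apply: (@continuous_big R _ +%R 0 xpredT (@add_continuous R)) => i _ x.
  apply: (@continuous_comp _ _ _ (fun x : 'rV[R]_n => x 0 i)
    (fun t => `|t| `^ p)).
    exact: coord_continuous.
  exact: continuous_norm_powR.
move=> x /= sx i; rewrite in_itv /= -ler_norml leNgt; apply/negP => x1.
have : 1 < `|x 0 i| `^ p.
  have <- : 1 `^ p = 1 :> R by rewrite powR1.
  by rewrite gt0_ltr_powR ?nnegrE.
rewrite -sx (bigD1 i)//= gtrDl ltNge sumr_ge0// => j _; exact: powR_ge0.
Qed.

Lemma psphere_nonempty (R : realType) (n : nat) (p : R) : (0 < n)%N -> 0 < p ->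
  @psphere R n p !=set0.
Proof.
case: n => // n _ p0; exists (delta_mx 0 0); apply/pnorm_eq1 => //.
rewrite (bigD1 ord0)//= mxE !eqxx normr1 powR1 big1 ?addr0// => i i0.
by rewrite mxE (negbTE i0) andbF normr0 powR0 ?gt_eqF.
Qed.

Lemma continuous_hpoly (R : realType) (n r : nat) (G : uhypergraph n r) :
  continuous (@hpoly R n r G).
Proof.
have cS : continuous (fun x : 'rV[R]_n =>
    \sum_(e in edges G) \prod_(i in e) x 0 i).
  apply: (@continuous_big R _ +%R 0 _ (@add_continuous R)) => e _.
  apply: (@continuous_big R _ *%R 1 _ (@mul_continuous R)) => i _.
  exact: coord_continuous.
by move=> x; exact: (@cvgMl_tmp R _ (nbhs x) _ _ r%:R _ (cS x)).
Qed.

Lemma pspectral_radius_max (R : realType) (n r : nat) (G : uhypergraph n r)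
    (p : R) : (0 < n)%N -> 0 < p ->
  exists2 x, pnorm p x = 1 & hpoly G x = pspectral_radius G p /\
    forall y, pnorm p y = 1 -> hpoly G y <= hpoly G x.
Proof.
move=> n0 p0.
have [x] := EVT_max_rV (psphere_nonempty n0 p0) (compact_psphere p0)
  (continuous_subspaceT (@continuous_hpoly R n r G)).
rewrite inE => x1 xmax; exists x => //.
have {}xmax y : pnorm p y = 1 -> hpoly G y <= hpoly G x.
  by move=> y1; apply: xmax; rewrite inE.
split=> //; apply/eqP; rewrite eq_le; apply/andP; split.
  by apply: ub_le_sup; [exists (hpoly G x) => _ [y /xmax ? <-]|exists x].
by apply: ge_sup; [exists (hpoly G x), x|move=> _ [y /xmax ? <-]].
Qed.

(* Main.v *)
(** In the variables [z i = `|x i| ^ p] the constraint becomes [\sum_i z i = 1],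
  whatever [p] is, and the objective at a fixed [z] has the form
  [p * F (p^-1)] with [F q = ln (r * \sum_e expR (q * ln (\prod_(i in e) z i)))]
  convex (the sum being over the edges on which the product is nonzero).  So it
  is the perspective of a convex function, hence convex in [p],
  and [hfun G] is a supremum of such functions.  Convexity of the perspective
  amounts to Hoelder's inequality with the weights [t * a / p] and
  [(1 - t) * b / p], where [p = t * a + (1 - t) * b]. *)
Require Import Defs.
From mathcomp Require Import all_boot all_order all_algebra.
From mathcomp Require Import all_classical all_reals all_analysis.
From mathcomp Require Import ring.
Import Order.TTheory GRing.Theory Num.Theory.
Import numFieldNormedType.Exports.

Local Open Scope classical_set_scope.
Local Open Scope ring_scope.

(** Young's inequality for [a]^ u[and]b [^ v] with conjugate exponents [u^-1] and [v^-1]; a zero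
    weight has no such exponent and is treated apart. *)
Lemma powR_weighted_AGM (R : realType) (a b u v : R) :
  0 <= a -> 0 <= b -> 0 <= u -> 0 <= v -> u + v = 1 ->
  a `^ u * b `^ v <= u * a + v * b.
Proof.
move=> a0 b0; rewrite le_eqVlt => /predU1P[<- _|u0].
  by rewrite add0r => ->; rewrite powRr0 powRr1// !mul1r mul0r add0r.
rewrite le_eqVlt => /predU1P[<-|v0 uv].
  by rewrite addr0 => ->; rewrite powRr0 powRr1// mulr1 mul1r mul0r addr0.
have := @conjugate_powR R (a `^ u) (b `^ v) u^-1 v^-1.
rewrite !powR_ge0 !invr_gt0 !invrK -!powRrM !divff ?gt_eqF// !powRr1//.
by move=> /(_ isT isT u0 v0 uv); rewrite (mulrC a) (mulrC b).
Qed.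

(** Weighted AGM for [a / l] and [b / m]. The right-hand side is linear in [a] and [b], so it can be
    summed over edges, and it equals [l]^ u * m [^ v] at [a = l], [b = m]. *)
Lemma powR_weighted_AGM_scaled (R : realType) (a b l m u v : R) :
  0 <= a -> 0 <= b -> 0 < l -> 0 < m -> 0 <= u -> 0 <= v -> u + v = 1 ->
  a `^ u * b `^ v <= l `^ u * m `^ v * (u / l * a + v / m * b).
Proof.
move=> a0 b0 l0 m0 u0 v0 uv.
have al0 : 0 <= a / l by rewrite divr_ge0// ltW.
have bm0 : 0 <= b / m by rewrite divr_ge0// ltW.
have -> : a `^ u * b `^ v = l `^ u * m `^ v * ((a / l) `^ u * (b / m) `^ v).
  rewrite mulrACA -!powRM ?(ltW l0) ?(ltW m0)//.
  by rewrite ![_ * (_ / _)]mulrC !divfK ?gt_eqF.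
have -> : u / l * a + v / m * b = u * (a / l) + v * (b / m) by ring.
by rewrite ler_pM2l ?mulr_gt0 ?powR_gt0// powR_weighted_AGM.
Qed.

Lemma prod_powR (R : realType) (I : finType) (A : {set I}) (f : I -> R)
    (q : R) : (forall i, 0 <= f i) ->
  \prod_(i in A) f i `^ q = (\prod_(i in A) f i) `^ q.
Proof.
move=> f0; suff [_ //] : 0 <= \prod_(i in A) f i /\
    \prod_(i in A) f i `^ q = (\prod_(i in A) f i) `^ q.
elim/big_rec2: _ => [|i x y _ [x0 ->]]; first by rewrite powR1.
by rewrite mulr_ge0// powRM.
Qed.

Lemma hpoly_le_pspectral_radius (R : realType) (n r : nat)
    (G : uhypergraph n r) (p : R) (x : 'rV[R]_n) : (0 < n)%N -> 0 < p ->
  \sum_i `|x 0 i| `^ p = 1 -> hpoly G x <= pspectral_radius G p.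
Proof.
move=> n0 p0 x1; have [y _ [<-]] := pspectral_radius_max G n0 p0.
by apply; apply/pnorm_eq1.
Qed.

Lemma pspectral_radius_gt0 (R : realType) (n r : nat) (G : uhypergraph n r)
    (p : R) : (0 < n)%N -> (0 < r)%N -> 0 < p ->
  (exists e, e \in edges G) -> 0 < pspectral_radius G p.
Proof.
move=> n0 r0 p0 [e eG].
have n0R : 0 < n%:R :> R by rewrite ltr0n.
(* With this value the constant vector has norm 1, and all its edge products are positive. *)
pose c : R := n%:R `^ (- p^-1).
have c0 : 0 < c by rewrite powR_gt0.
apply: (@lt_le_trans _ _ (hpoly G (const_mx c))); last first.
  apply: hpoly_le_pspectral_radius => //.
  under eq_bigr do rewrite mxE gtr0_norm// -powRrM mulNr mulVf ?gt_eqF//.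
  by rewrite sumr_const card_ord powR_inv1 ?ltW// -[LHS]mulr_natl divff ?gt_eqF.
rewrite /hpoly mulr_gt0 ?ltr0n// (bigD1 e)//=.
have P0 (f : {set 'I_n}) : 0 < \prod_(i in f) (const_mx c : 'rV[R]_n) 0 i.
  by apply: prodr_gt0 => i _; rewrite mxE.
by rewrite ltr_wpDr ?P0// sumr_ge0// => f _; exact/ltW/P0.
Qed.

(** Hoelder's inequality, proved edge by edge from the scaled AGM inequality with the two spectral
    radii as scales. *)
Lemma hpoly_le_powR_pspectral_radius (R : realType) (n r : nat)
    (G : uhypergraph n r) (a b t : R) (p := t * a + (1 - t) * b)
    (x : 'rV[R]_n) :
  (0 < n)%N -> (0 < r)%N -> (exists e, e \in edges G) ->
  0 < a -> 0 < b -> 0 < p -> 0 <= t -> t <= 1 ->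
  \sum_i `|x 0 i| `^ p = 1 ->
  hpoly G x <= pspectral_radius G a `^ (t * a / p) *
                     pspectral_radius G b `^ ((1 - t) * b / p).
Proof.
move=> n0 r0 hE a0 b0 p0 t0 t1 x1.
have La := pspectral_radius_gt0 R n r G a n0 r0 a0 hE.
have Lb := pspectral_radius_gt0 R n r G b n0 r0 b0 hE.
set la := pspectral_radius G a in La *.
set lb := pspectral_radius G b in Lb *.
set u := t * a / p; set v := (1 - t) * b / p.
have u0 : 0 <= u by rewrite divr_ge0 ?mulr_ge0// ltW.
have v0 : 0 <= v by rewrite divr_ge0 ?mulr_ge0 ?subr_ge0// ltW.
have uv : u + v = 1 by rewrite -mulrDl divff ?gt_eqF.
pose y c : 'rV[R]_n := \row_i `|x 0 i| `^ (p / c).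
have hy c : 0 < c -> hpoly G (y c) <= pspectral_radius G c.
  move=> c0; apply: hpoly_le_pspectral_radius => //; rewrite -x1.
  apply: eq_bigr => i _.
  by rewrite mxE ger0_norm ?powR_ge0// -powRrM divfK ?gt_eqF.
have hya : hpoly G (y a) <= la by exact: hy.
have hyb : hpoly G (y b) <= lb by exact: hy.
clearbody la lb; set M := la `^ u * lb `^ v.
have M0 : 0 < M by rewrite mulr_gt0 ?powR_gt0.
have edge (e : {set 'I_n}) : \prod_(i in e) x 0 i <=
    M * (u / la * \prod_(i in e) y a 0 i + v / lb * \prod_(i in e) y b 0 i).
  apply: le_trans (ler_norm _) _; rewrite normr_prod.
  have yE c : \prod_(i in e) y c 0 i = (\prod_(i in e) `|x 0 i|) `^ (p / c).
    by under eq_bigr do rewrite mxE; exact: prod_powR.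
  rewrite !yE; set X := \prod_(i in e) `|x 0 i|.
  have X0 : 0 <= X by exact: prodr_ge0.
  (* The exponents multiply out to [t] and [1 - t]; as their sum is nonzero, the powers combine even
     when [X = 0]. *)
  have {1}-> : X = X `^ (p / a) `^ u * X `^ (p / b) `^ v.
    rewrite -!powRrM.
    have -> : p / a * u = t by rewrite /u; field; rewrite !gt_eqF.
    have -> : p / b * v = 1 - t by rewrite /v; field; rewrite !gt_eqF.
    by rewrite -powRD addrC subrK ?oner_eq0// powRr1.
  by apply: powR_weighted_AGM_scaled; rewrite ?powR_ge0.
clearbody M u v.
(* Bounding the two values of [hpoly] by [la] and [lb] leaves [M * (u + v)], which is [M]. *)
have uvM : M * (u / la * la + v / lb * lb) = M.
  by rewrite !divfK ?gt_eqF// uv mulr1.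
rewrite -[leRHS]uvM.
apply: (@le_trans _ _ (M * (u / la * hpoly G (y a) +
                            v / lb * hpoly G (y b)))).
  rewrite /hpoly.
  have -> (A B : R) : M * (u / la * (r%:R * A) + v / lb * (r%:R * B)) =
      r%:R * (M * (u / la * A + v / lb * B)) by ring.
  rewrite ler_wpM2l// [u / la * _]mulr_sumr [v / lb * _]mulr_sumr -big_split.
  by rewrite mulr_sumr; apply: ler_sum => e _; exact: edge.
by rewrite ler_pM2l// lerD// ler_wpM2l// divr_ge0// ltW.
Qed.

Theorem theorem3p7 (R : realType) (n r : nat) (G : uhypergraph n r)
    (hE : exists e, e \in edges G) :
  convex_function (`]r%:R, +oo[%classic : set R) (hfun G).
Proof.
(* For [r = 0] the factor [r%:R] kills [hpoly]; the supremum is 0 even over an empty sphere, and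
   [ln 0 = 0] makes [hfun G] vanish. *)
have [r0|r0] := posnP r.
  have h0 (p : R) : hfun G p = 0.
    rewrite /hfun /pspectral_radius.
    have /subset_set1[->|->] : [set hpoly G x | x in @psphere R n p] `<=` [set 0].
    - by move=> _ [x _ <-]; rewrite /hpoly (_ : r%:R = 0) ?mul0r// r0.
    - by rewrite sup0 ln0// mulr0.
    - by rewrite sup1 ln0// mulr0.
  by move=> t a b _ _; rewrite convRE !h0 !mulr0 addr0.
have n0 : (0 < n)%N.
  case: hE => e /edges_uniform er.
  by rewrite (leq_trans r0)// -er -[leqRHS]card_ord max_card.
move=> t a b; rewrite !inE /= !in_itv /= !andbT => ra rb.
have a0 : 0 < a by apply: le_lt_trans ra; exact: ler0n.
have b0 : 0 < b by apply: le_lt_trans rb; exact: ler0n.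
have p0 : 0 < t%:num * a + (1 - t%:num) * b := convR_gt0 t a0 b0.
have [t0 t1] : 0 <= t%:num /\ t%:num <= 1 by split.
set s := t%:num in p0 t0 t1; set p := s * a + _ in p0.
change (hfun G p <= s * hfun G a + (1 - s) * hfun G b); rewrite /hfun.
have La := pspectral_radius_gt0 R n r G a n0 r0 a0 hE.
have Lb := pspectral_radius_gt0 R n r G b n0 r0 b0 hE.
(* At a maximizer for [p], the Hoelder bound becomes a bound on the spectral radius itself. *)
have [x x1 [xE _]] := pspectral_radius_max G n0 p0.
have /pnorm_eq1 - /(_ p0) {}x1 := x1.
have := hpoly_le_powR_pspectral_radius R n r G a b s x n0 r0 hE a0 b0 p0 t0 t1 x1.
have Lp := pspectral_radius_gt0 R n r G p n0 r0 p0 hE.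
rewrite xE -/p; move: Lp La Lb; clearbody p.
move: (pspectral_radius G p) (pspectral_radius G a) (pspectral_radius G b).
move=> lp la lb Lp La Lb.
(* After taking logarithms, multiplying by [p] cancels the denominator of the weights [s * a / p]
   and [(1 - s) * b / p]. *)
rewrite -ler_ln ?posrE ?mulr_gt0 ?powR_gt0//.
rewrite lnM ?posrE ?powR_gt0// !ln_powR -(ler_pM2l p0) => /le_trans; apply.
by rewrite le_eqVlt; apply/orP; left; apply/eqP; field; rewrite gt_eqF.
Qed.
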